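(* Let $n\in\mathbb{N}\cup\{0\}$, $0\le i\le n-1$ and $\alpha>-1$. Let $t_1<\dots<t_n$ be the zeros of $L_n^{(\alpha)}$. Then $$\int_0^\infty\frac{t^i}{i!}|\ell_n^{(\alpha)}(t)|\,dt=2\sum_{m=1}^n(-1)^{m+1}\sum_{k=0}^i\frac{(-1)^k}{(i-k)!}\,t_m^{i-k}\,\ell_{n-1-k}^{(\alpha+1+k)}(t_m).$$
   Context: The generalized Laguerre polynomials are $L_n^{(\alpha)}(t)=\sum_{k=0}^n(-1)^k\binom{n+\alpha}{n-k}\frac{t^k}{k!}$, and the Laguerre functions are $\ell_n^{(\alpha)}(t)=\frac{n!}{\Gamma(n+\alpha+1)}t^{\alpha}e^{-t}L_n^{(\alpha)}(t)$ for $t>0$. For $\alpha>-1$ the zeros of $L_n^{(\alpha)}$ are real, simple and positive. *)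

(* Defs.v *)
From HB Require Import structures.
From mathcomp Require Import all_boot all_order all_algebra.
From mathcomp Require Import all_classical all_reals all_analysis.
Set Implicit Arguments. Unset Strict Implicit. Unset Printing Implicit Defensive.
Import Order.TTheory GRing.Theory Num.Theory.
Import numFieldNormedType.Exports.
Local Open Scope classical_set_scope.
Local Open Scope ring_scope.

(* Euler Gamma function, Gamma x = int_0^oo t^(x-1) e^(-t) dt (finite for x>0). *)
Definition Gamma {R : realType} (x : R) : R :=
  fine (\int[@lebesgue_measure R]_(t in `](0%R : R), +oo[%classic)
          ((powR t (x - 1)) * expR (- t))%:E).

Definition gbinom {R : realType} (x : R) (m : nat) : R :=
  (\prod_(j < m) (x - j%:R)) / (m`!)%:R.

Definition laguerreL {R : realType} (n : nat) (a t : R) : R :=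
  \sum_(k < n.+1) (-1) ^+ k * gbinom (n%:R + a) (n - k) * t ^+ k / (k`!)%:R.

Definition laguerre_fun {R : realType} (n : nat) (a t : R) : R :=
  (n`!)%:R / Gamma (n%:R + a + 1) * powR t a * expR (- t) * laguerreL n a t.

(* Main.v *)
(* Since (l_n^(b+1))' = l_(n+1)^(b), integrating by parts i times shows that the
   alternating sum F(x) = sum_k (-1)^k / (i-k)! x^(i-k) l_(n-1-k)^(a+1+k)(x) is a
   primitive of x^i / i! l_n^(a)(x); it vanishes at infinity, and at 0 because
   a > -1. As L_n^(a) has degree n and leading coefficient (-1)^n / n!, it equals
   (1/n!) prod_j (t_j - x), hence has sign (-1)^m between t_m and t_(m+1) (with
   t_0 = 0 and t_(n+1) = +oo). Summing the increments of (-1)^m F over these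
   intervals counts each F(t_m) twice. *)
Require Import Defs.
From HB Require Import structures.
From mathcomp Require Import all_boot all_order all_algebra.
From mathcomp Require Import all_classical all_reals all_analysis.
From mathcomp Require Import measurable_realfun.
From mathcomp Require Import ring lra.
Import Order.TTheory GRing.Theory Num.Theory.
Import numFieldNormedType.Exports.
Local Open Scope classical_set_scope.
Local Open Scope ring_scope.

(** * Integrals of functions with a known primitive and alternating sign *)

Lemma is_derive_continuous (R : realType) (f : R -> R) (x df : R) :
  is_derive x 1 f df -> {for x, continuous f}.
Proof. by move=> [/derivable1_diffP /differentiable_continuous]. Qed.

(* Only the half-open interval is used, as [f] may be unbounded near [u]: the
   integral is the monotone limit of the integrals over [u + 1/(k+1), v]. *)
Lemma ge0_FTC2_oc (R : realType) (f F : R -> R) (u v : R) : u < v ->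
  (forall x, u < x -> is_derive x 1 F (f x)) ->
  (forall x, u < x -> {for x, continuous f}) ->
  (forall x, u < x <= v -> 0 <= f x) ->
  F x @[x --> u^'+] --> F u ->
  (\int[@lebesgue_measure R]_(x in `]u, v]) (f x)%:E = (F v - F u)%:E)%E.
Proof.
move=> uv dF cf f0 Fu.
pose A k := `[u + k.+1%:R^-1, v]%classic : set R.
have uk k : u < u + k.+1%:R^-1 by rewrite ltrDl invr_gt0.
have Asub k x : A k x -> u < x <= v.
  by rewrite /A/= in_itv/= => /andP[ux ->]; rewrite (lt_le_trans (uk k)).
have AE : `]u, v]%classic = \bigcup_k A k by rewrite itv_open_bnd_bigcup.
have cvgA : (\int[@lebesgue_measure R]_(x in A k) (f x)%:E @[k --> \oo] -->
    \int[@lebesgue_measure R]_(x in `]u, v]) (f x)%:E)%E.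
  rewrite AE; apply: ge0_nondecreasing_set_cvg_integral.
  - apply/nondecreasing_seqP => k; rewrite subsetEset => x; rewrite /A/= !in_itv/=.
    move=> /andP[ux ->]; rewrite andbT (le_trans _ ux)// lerD2l lef_pV2 ?posrE//.
    by rewrite ler_nat.
  - by move=> k; exact: measurable_itv.
  - move=> k; apply/measurable_EFinP.
    apply: (@measurable_funS _ _ _ _ `]u, +oo[%classic) => //.
      by move=> x /Asub /andP[ux _]; rewrite /= in_itv/= ux.
    apply: open_continuous_measurable_fun; first exact: interval_open.
    by move=> x; rewrite inE/= in_itv/= andbT; exact: cf.
  - by move=> k x /Asub; rewrite lee_fin; exact: f0.
have cvgF : ((F v - F (u + k.+1%:R^-1))%:E @[k --> \oo] --> (F v - F u)%:E)%E.
  apply: cvg_EFin; first exact: nearW.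
  apply: cvgB; first exact: cvg_cst.
  move/cvg_at_rightP : Fu; apply; split=> //.
  rewrite -[X in _ --> X]addr0; apply: cvgD; first exact: cvg_cst.
  exact: cvg_harmonic.
(* The two sequences agree as soon as u + 1/(k+1) < v, by the fundamental theorem on the closed
   interval. *)
apply: (cvg_unique _ cvgA) => //; apply: cvg_trans cvgF; apply: near_eq_cvg.
have vu : 0 < v - u by rewrite subr_gt0.
have [k0 _ Hk0] := near_infty_natSinv_lt (PosNum vu).
exists k0 => // k /Hk0/= kvu.
rewrite /A (@continuous_FTC2 _ _ F) ?EFinB//.
- by rewrite -ltrBrDl.
- apply: continuous_in_subspaceT => x; rewrite inE/= => /Asub/andP[ux _].
  exact: cf.
- split.
  + move=> x; rewrite in_itv/= => /andP[ux _].
    by have [] := dF x (lt_trans (uk k) ux).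
  + apply: cvg_at_right_filter; apply: is_derive_continuous; exact: dF.
  + apply: cvg_at_left_filter; apply: is_derive_continuous; exact: dF.
- move=> x; rewrite in_itv/= => /andP[ux _].
  by have [_ <-] := dF x (lt_trans (uk k) ux); rewrite derive1E.
Qed.

(** Each value ends one increment and starts the next, and the alternating signs make both
    contributions equal. For g(n) the second one is the extra term, the increment from g(n) to a
    limit 0. *)
Lemma telescope_alternating (R : realType) (g : nat -> R) (n : nat) : g 0 = 0 ->
  \sum_(m < n) (-1) ^+ m * (g m.+1 - g m) - (-1) ^+ n * g n =
  2 * \sum_(m < n) (-1) ^+ m * g m.+1.
Proof.
move=> g0; elim: n => [|n IHn]; first by rewrite !big_ord0 g0 !mulr0 subr0.
rewrite !big_ord_recr/= [RHS]mulrDr -IHn exprS; ring.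
Qed.

(** As f may be unbounded near [s 0], only the value and the right limit of F are prescribed there.
    The case m = n of the sign hypothesis is the unbounded interval beyond [s n]. *)
Lemma integral_norm_alternating (R : realType) (f F : R -> R) (s : nat -> R)
    (n : nat) :
  (0 < n)%N -> (forall m, (m < n)%N -> s m < s m.+1) ->
  (forall x, s 0 < x -> is_derive x 1 F (f x)) ->
  (forall x, s 0 < x -> {for x, continuous f}) ->
  (forall m x, (m <= n)%N -> s m <= x -> ((m < n)%N -> x <= s m.+1) ->
     `|f x| = (-1) ^+ m * f x) ->
  F (s 0) = 0 -> F x @[x --> (s 0)^'+] --> 0 -> F x @[x --> +oo] --> 0 ->
  (\int[@lebesgue_measure R]_(x in `]s 0%N, +oo[) (`|f x|)%:E =
   (2 * \sum_(m < n) (-1) ^+ m * F (s m.+1))%:E)%E.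
Proof.
move=> n_gt0 s_lt dF cf f_sign F0 Fs0 Fy.
have s_ge m : (m <= n)%N -> s 0 <= s m.
  by elim: m => // m IHm mn; rewrite (le_trans (IHm (ltnW mn)))// ltW// s_lt.
have cnf x : s 0 < x -> {for x, continuous (fun x => `|f x|)}.
  by move=> /cf cfx; apply: continuous_comp => //; exact: norm_continuous.
have mf : measurable_fun `]s 0, +oo[ (fun x => (`|f x|)%:E).
  apply/measurable_EFinP.
  apply: open_continuous_measurable_fun; first exact: interval_open.
  by move=> x; rewrite inE/= in_itv/= andbT; exact: cnf.
have dsF m x : s 0 < x ->
    is_derive x 1 (fun x => (-1) ^+ m * F x) ((-1) ^+ m * f x).
  by move=> /dF dFx; exact: is_deriveZ.
have csf m x : s 0 < x -> {for x, continuous (fun x => (-1) ^+ m * f x)}.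
  by move=> /cf cfx; apply: cvgM => //; exact: cvg_cst.
have FsF m : (m <= n)%N -> F x @[x --> (s m)^'+] --> F (s m).
  case: m => [|m] mn; first by rewrite F0.
  apply/cvg_at_right_filter/is_derive_continuous/dF.
  by rewrite (le_lt_trans (s_ge m (ltnW mn)))// s_lt.
have piece m : (m < n)%N ->
    (\int[@lebesgue_measure R]_(x in `]s m, s m.+1]) (`|f x|)%:E =
     ((-1) ^+ m * (F (s m.+1) - F (s m)))%:E)%E.
  move=> mn; have s0m := s_ge m (ltnW mn).
  have fE x : s m < x <= s m.+1 -> `|f x| = (-1) ^+ m * f x.
    by move=> /andP[/ltW mx xm]; apply: f_sign => //; exact: ltnW.
  under eq_integral => x.
    rewrite inE/= in_itv/= => /fE ->; over.
  have dsFm x : s m < x -> _ := fun mx => dsF m x (le_lt_trans s0m mx).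
  rewrite (ge0_FTC2_oc _ _ _ _ _ (s_lt m mn) dsFm) ?mulrBr//.
  - by move=> x mx; apply: csf; exact: le_lt_trans mx.
  - by move=> x /fE <-.
  - by apply: cvgM; [exact: cvg_cst|exact/FsF/ltnW].
have initial m : (m <= n)%N ->
    (\int[@lebesgue_measure R]_(x in `]s 0%N, s m]) (`|f x|)%:E =
     (\sum_(j < m) (-1) ^+ j * (F (s j.+1) - F (s j)))%:E)%E.
  elim: m => [_|m IHm mn]; first by rewrite set_itvoc0 integral_set0 big_ord0.
  have mSm := ltW (s_lt m mn).
  rewrite big_ord_recr/= EFinD -(IHm (ltnW mn)) -(piece m mn).
  rewrite (@itv_bndbnd_setU _ _ _ (BRight (s m)))//; last first.
    by rewrite bnd_simp s_ge// ltnW.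
  rewrite ge0_integral_setU//.
  - apply: measurable_funS mf => //.
    rewrite -itv_bndbnd_setU ?bnd_simp ?s_ge// 1?ltnW//.
    by apply: subset_itvl; rewrite bnd_simp.
  - by apply/disj_setPLR => x /=; rewrite !in_itv/= => /andP[_ xm];
    rewrite ltNge xm.
have last : (\int[@lebesgue_measure R]_(x in `]s n, +oo[) (`|f x|)%:E =
     (- ((-1) ^+ n * F (s n)))%:E)%E.
  (* Strictness, from n > 0, puts the closed ray from [s n] inside the region where f is continuous
     and F derivable. *)
  have s0n : s 0 < s n.
    case: {+}n n_gt0 s_ge s_lt => // n' _ s_ge /(_ n' (ltnSn _)).
    by apply: le_lt_trans; exact: s_ge.
  have fE x : s n <= x -> `|f x| = (-1) ^+ n * f x.
    by move=> nx; apply: f_sign; rewrite ?ltnn.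
  rewrite integral_itv_obnd_cbnd; last first.
    apply: measurable_funS mf => //.
    by apply: subset_itvr; rewrite bnd_simp s_ge.
  under eq_integral => x.
    rewrite inE/= in_itv/= andbT => /fE ->; over.
  rewrite (@ge0_continuous_FTC2y _ _ (fun x => (-1) ^+ n * F x) _ 0) ?sub0e//.
  - by move=> x /fE <-.
  - apply: continuous_in_subspaceT => x; rewrite inE/= in_itv/= andbT => nx.
    by apply: csf; exact: lt_le_trans nx.
  - rewrite -[X in _ --> X](mulr0 ((-1) ^+ n)).
    by apply: cvgM => //; exact: cvg_cst.
  - by move=> x nx; have [] := dsF n x (lt_trans s0n nx).
  - by apply: cvgM; [exact: cvg_cst|exact: FsF].
  - move=> x; rewrite in_itv/= andbT => nx.
    by have [_ <-] := dsF n x (lt_trans s0n nx); rewrite derive1E.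
rewrite -(telescope_alternating _ (fun m => F (s m)))// EFinD -initial// -last.
rewrite (@itv_bndbnd_setU _ _ _ (BRight (s n)))//; last first.
  by rewrite bnd_simp s_ge.
rewrite ge0_integral_setU//.
- by rewrite -itv_bndbnd_setU ?bnd_simp ?s_ge.
- by apply/disj_setPLR => x /=; rewrite !in_itv/= => /andP[_ xm];
    rewrite ltNge xm.
Qed.

(** * Laguerre polynomials: coefficients, derivative relation, factorization *)

Lemma gbinomS (R : realType) (x : R) (m : nat) :
  m.+1%:R * gbinom x m.+1 = (x - m%:R) * gbinom x m.
Proof.
rewrite /gbinom big_ord_recr/= factS natrM.
have m0 : m.+1%:R != 0 :> R by rewrite pnatr_eq0.
have mf0 : m`!%:R != 0 :> R by rewrite pnatr_eq0 -lt0n fact_gt0.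
by field; rewrite mf0 nat1r.
Qed.

Definition laguerre_poly {R : realType} (n : nat) (a : R) : {poly R} :=
  \poly_(k < n.+1) ((-1) ^+ k * gbinom (n%:R + a) (n - k) / k`!%:R).

Lemma horner_laguerre_poly (R : realType) n (a x : R) :
  (laguerre_poly n a).[x] = laguerreL n a x.
Proof. by rewrite horner_poly; apply: eq_bigr => k _; rewrite mulrAC. Qed.

Lemma coef_laguerre_poly (R : realType) n (a : R) k : (k <= n)%N ->
  (laguerre_poly n a)`_k = (-1) ^+ k * gbinom (n%:R + a) (n - k) / k`!%:R.
Proof. by move=> kn; rewrite coef_poly ltnS kn. Qed.

Lemma lead_coef_laguerre_poly (R : realType) n (a : R) :
  lead_coef (laguerre_poly n a) = (-1) ^+ n / n`!%:R.
Proof.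
rewrite lead_coef_poly// subnn /gbinom big_ord0 divr1 mulr1 //.
by rewrite mulf_neq0 ?signr_eq0// invr_eq0 pnatr_eq0 -lt0n fact_gt0.
Qed.

Lemma size_laguerre_poly (R : realType) n (a : R) :
  size (laguerre_poly n a) = n.+1.
Proof.
rewrite size_poly_eq// subnn /gbinom big_ord0 divr1 mulr1 //.
by rewrite mulf_neq0 ?signr_eq0// invr_eq0 pnatr_eq0 -lt0n fact_gt0.
Qed.

(* The polynomial part of (x^(a+1) e^-x L_n^(a+1))' = (n+1) x^a e^-x L_(n+1)^(a). *)
Lemma laguerre_poly_step (R : realType) n (a : R) :
  (a + 1)%:P * laguerre_poly n (a + 1) - 'X * laguerre_poly n (a + 1)
    + 'X * (laguerre_poly n (a + 1))^`()
  = n.+1%:R%:P * laguerre_poly n.+1 a.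
Proof.
have y_eq : n%:R + (a + 1) = n.+1%:R + a :> R by rewrite -natr1; ring.
apply/polyP => -[|k]; rewrite coefD coefB !coefCM !coefXM coef_deriv/=.
  rewrite !coef_laguerre_poly// !subn0 y_eq !expr0 fact0 divr1 !mul1r addr0 subr0.
  by rewrite divr1 gbinomS -natr1; congr (_ * _); ring.
(* Coefficients of X^(k+1). For k < n put n = k + d + 1; for k > n both sides vanish; for k = n only
   the leading coefficients of X L_n^(a+1) and L_(n+1)^(a) remain. *)
case: (ltngtP k n) => [kn|nk|->{k}].
- have [d nE] : exists d, n = (k + d).+1 by exists (n - k.+1)%N; rewrite -addSn subnKC.
  rewrite !coef_laguerre_poly ?ltnS ?(ltnW kn)// y_eq.
  have -> : (n - k.+1)%N = d by rewrite nE subSS addKn.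
  have -> : (n - k)%N = d.+1 by rewrite nE -addnS addKn.
  have -> : (n.+1 - k.+1)%N = d.+1 by rewrite nE subSS -addnS addKn.
  have := gbinomS _ (n.+1%:R + a) d.
  set g := gbinom _ d; set g1 := gbinom _ d.+1.
  have -> : n.+1%:R = k%:R + d%:R + 2 :> R by rewrite nE -!natr1 natrD; ring.
  rewrite -natr1 => gS; rewrite factS natrM -mulr_natr exprS -natr1.
  have mf0 : k`!%:R != 0 :> R by rewrite pnatr_eq0 -lt0n fact_gt0.
  have k0 : k%:R + 1 != 0 :> R by rewrite natr1 pnatr_eq0.
  (* The multiplier (a + 1) + (k + 1) of g is (n + 1 + a) - d, so [gS] applies; then (d + 1) + (k +
     1) = n + 1. *)
  transitivity ((-1) * (-1) ^+ k / ((k%:R + 1) * k`!%:R) *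
      ((k%:R + d%:R + 2 + a - d%:R) * g + (k%:R + 1) * g1)).
    by field; rewrite mf0 k0.
  by rewrite -gS; field; rewrite mf0 k0.
- by rewrite !nth_default ?size_laguerre_poly ?mulr0 ?mul0rn ?subr0 ?addr0// ltnW.
- rewrite (@nth_default _ _ _ n.+1) ?size_laguerre_poly// mul0rn mulr0 addr0 sub0r.
  rewrite !coef_laguerre_poly// !subnn /gbinom !big_ord0 factS natrM exprS.
  have mf0 : n`!%:R != 0 :> R by rewrite pnatr_eq0 -lt0n fact_gt0.
  have n0 : n.+1%:R != 0 :> R by rewrite pnatr_eq0.
  by field; rewrite mf0 nat1r n0 fact0 mulr1n oner_neq0.
Qed.

(** For x <= 0 each (-1)^k x^k is nonnegative, and a > -1 makes every binomial factor n + a - j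
    positive; the term k = 0 is positive. Hence all real zeros are positive. *)
Lemma laguerreL_gt0 (R : realType) n (a x : R) : -1 < a -> x <= 0 ->
  0 < laguerreL n a x.
Proof.
move=> a_gt x_le0.
have gbinom_gt0 m : (m <= n)%N -> 0 < gbinom (n%:R + a) m.
  move=> mn; rewrite divr_gt0 ?ltr0n ?fact_gt0//.
  apply: prodr_gt0 => j _.
  have : (j.+1%:R <= n%:R :> R) by rewrite ler_nat (leq_trans _ mn).
  by rewrite -natr1; lra.
rewrite /laguerreL big_ord_recl/= ltr_pwDl//.
  by rewrite subn0 !mul1r mulr1 divr1 gbinom_gt0.
apply: sumr_ge0 => k _; rewrite mulr_ge0 ?invr_ge0//.
rewrite mulrAC -exprMn mulr_ge0 ?(ltW (gbinom_gt0 _ _)) ?leq_subr//.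
by apply: exprn_ge0; rewrite mulN1r oppr_ge0.
Qed.

(** The n distinct zeros exhaust the degree; the sign (-1)^n of the leading coefficient is spread
    over the factors, turning x - t_j into t_j - x. *)
Lemma laguerreL_prod (R : realType) n (a : R) (t : 'I_n -> R) :
  {homo t : j k / (j < k)%N >-> j < k} ->
  (forall m, laguerreL n a (t m) = 0) ->
  forall x, laguerreL n a x = n`!%:R^-1 * \prod_(j < n) (t j - x).
Proof.
move=> t_lt t_root x.
have t_inj : injective t.
  move=> j k tjk; case: (ltngtP j k) => [jk|kj|jk]; last exact: ord_inj.
  - by have := t_lt _ _ jk; rewrite tjk ltxx.
  - by have := t_lt _ _ kj; rewrite tjk ltxx.
have size_t : size (codom t) = n by rewrite size_codom card_ord.
rewrite -horner_laguerre_poly (@all_roots_prod_XsubC _ (laguerre_poly n a) (codom t)).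
- rewrite big_image/= hornerZ horner_prod lead_coef_laguerre_poly mulrAC mulrC.
  congr (_ * _).
  rewrite -[X in _ ^+ X](card_ord n) -prodr_const -big_split/=.
  by apply: eq_bigr => j _; rewrite hornerXsubC mulN1r opprB.
- by rewrite size_laguerre_poly size_t.
- by apply/allP => _ /codomP[m ->]; rewrite rootE horner_laguerre_poly t_root.
- by rewrite uniq_rootsE; apply/injectiveP.
Qed.

(** The first m factors are nonpositive, the others nonnegative; writing (-1)^m as a product over
    all j allows a comparison factor by factor. *)
Lemma norm_prod_sign (R : realDomainType) n (t : 'I_n -> R) (m : nat) (x : R) :
  (m <= n)%N ->
  (forall j : 'I_n, (j < m)%N -> t j <= x) ->
  (forall j : 'I_n, (m <= j)%N -> x <= t j) ->
  `|\prod_(j < n) (t j - x)| = (-1) ^+ m * \prod_(j < n) (t j - x).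
Proof.
move=> mn t_le t_ge.
have -> : (-1) ^+ m = \prod_(j < n) (if (j < m)%N then -1 else 1 : R).
  rewrite -big_mkcond/= -(big_ord_widen _ (fun=> -1) mn).
  by rewrite prodr_const card_ord.
rewrite normr_prod -big_split/=; apply: eq_bigr => j _.
case: ltnP => [/t_le tx|/t_ge xt]; last by rewrite mul1r ger0_norm// subr_ge0.
by rewrite mulN1r ler0_norm// subr_le0.
Qed.

(** * Laguerre functions: normalization, derivative, primitive *)

(** [fine] sends an infinite integral to 0, so the bound holds for every x. *)
Lemma Gamma_ge0 (R : realType) (x : R) : 0 <= Gamma x.
Proof.
by apply/fine_ge0/integral_ge0 => y _; rewrite lee_fin mulr_ge0 ?powR_ge0 ?expR_ge0.
Qed.

Lemma powRD1 (R : realType) (a x : R) : 0 < x -> powR x (a + 1) = powR x a * x.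
Proof.
move=> x0; rewrite powRD; first by rewrite powRr1 ?(ltW x0).
by rewrite (gt_eqF x0) implybT.
Qed.

Lemma is_derive_powR_expRN (R : realType) (a x : R) : 0 < x ->
  is_derive x 1 (fun x => powR x (a + 1) * expR (- x))
    ((a + 1 - x) * (powR x a * expR (- x))).
Proof.
move=> x0; have dp := is_derive1_powR (a + 1) x0.
have -> : (fun x => powR x (a + 1) * expR (- x)) =
  ((fun x => powR x (a + 1)) * (expR \o -%R)) :> (R -> R) by [].
have de : is_derive x 1 (expR \o -%R) (expR (- x) *: -1).
  exact: is_derive1_comp.
apply: is_derive_eq.
rewrite /GRing.scale/= -addrA subrr addr0.
rewrite powRD1//; ring.
Qed.

(** The product rule reduces this to [laguerre_poly_step], whose factor n + 1 turns n! into (n+1)!;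
    both Gamma arguments equal n + a + 2. *)
Lemma is_derive_laguerre_fun (R : realType) n (a x : R) : 0 < x ->
  is_derive x 1 (laguerre_fun n (a + 1)) (laguerre_fun n.+1 a x).
Proof.
move=> x0; have dw := is_derive_powR_expRN _ a _ x0.
pose K : R := n`!%:R / Gamma (n%:R + (a + 1) + 1).
have -> : laguerre_fun n (a + 1) = (K \*: ((fun x => powR x (a + 1) * expR (- x)) *
    horner (laguerre_poly n (a + 1)))) :> (R -> R).
  apply/funext => y; rewrite /laguerre_fun -horner_laguerre_poly.
  by rewrite -/K -[RHS]/(K * (_ * _ * _)) !mulrA.
apply: is_derive_eq.
have := congr1 (horner^~ x) (laguerre_poly_step _ n a).
rewrite !hornerE/= => step.
rewrite /laguerre_fun -horner_laguerre_poly factS natrM.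
have -> : n.+1%:R + a + 1 = n%:R + (a + 1) + 1 :> R by rewrite -natr1; ring.
rewrite powRD1//.
rewrite /K /GRing.scale/=.
transitivity (n`!%:R / Gamma (n%:R + (a + 1) + 1) * powR x a * expR (- x) *
   (n.+1%:R * (laguerre_poly n.+1 a).[x])); last by ring.
by rewrite -step; ring.
Qed.

(** This is F for b = a + 1, with [n] one less than the degree of the Laguerre polynomial being
    integrated. For i <= n no difference n - k is truncated. *)
Definition laguerre_primitive {R : realType} (i n : nat) (b x : R) : R :=
  \sum_(k < i.+1) (-1) ^+ k / ((i - k)`!)%:R * x ^+ (i - k) *
    laguerre_fun (n - k) (b + k%:R) x.

Lemma laguerre_primitive0 (R : realType) n (b : R) :
  laguerre_primitive 0 n b = laguerre_fun n b.
Proof.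
apply/funext => x; rewrite /laguerre_primitive big_ord1 !subn0 fact0 divr1.
by rewrite !expr0 !mul1r addr0.
Qed.

(** One integration by parts: k = 0 gives the boundary term, and shifting k in the rest lowers i and
    n, raises b and flips the sign. *)
Lemma laguerre_primitiveS (R : realType) i n (b x : R) :
  laguerre_primitive i.+1 n.+1 b x =
  x ^+ i.+1 / i.+1`!%:R * laguerre_fun n.+1 b x - laguerre_primitive i n (b + 1) x.
Proof.
rewrite /laguerre_primitive big_ord_recl/= !subn0 addr0 expr0 div1r.
congr (_ + _); first by rewrite [_^-1 * _]mulrC.
rewrite -sumrN; apply: eq_bigr => k _; rewrite /bump/= add1n !subSS exprS.
by rewrite -addrA nat1r -!mulNr mulN1r.
Qed.

(** In the induction, differentiating x^(i+1)/(i+1)! produces x^i/i! l_(n+1)^(a+1), which cancels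
    against the derivative of the remaining primitive, known at a + 1. *)
Lemma is_derive_laguerre_primitive (R : realType) i n (a x : R) :
  (i <= n)%N -> 0 < x ->
  is_derive x 1 (laguerre_primitive i n (a + 1))
    (x ^+ i / i`!%:R * laguerre_fun n.+1 a x).
Proof.
move=> + x0; elim: i n a => [|i IHi] [|n] a //; rewrite ?ltnS => ilen.
- by rewrite laguerre_primitive0 fact0 divr1 expr0 mul1r; exact: is_derive_laguerre_fun.
- by rewrite laguerre_primitive0 fact0 divr1 expr0 mul1r; exact: is_derive_laguerre_fun.
have dP := IHi n (a + 1) ilen; have dl := is_derive_laguerre_fun _ n.+1 a _ x0.
have -> : laguerre_primitive i.+1 n.+1 (a + 1) =
    (i.+1`!%:R^-1 \*: ((@id R) ^+ i.+1 * laguerre_fun n.+1 (a + 1))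
     - laguerre_primitive i n (a + 1 + 1)) :> (R -> R).
  apply/funext => y; rewrite laguerre_primitiveS.
  by rewrite !fctE/= /GRing.scale/= [in RHS]mulrCA mulrA.
apply: is_derive_eq.
rewrite /GRing.scale/= factS natrM.
have i0 : i.+1%:R != 0 :> R by rewrite pnatr_eq0.
have if0 : i`!%:R != 0 :> R by rewrite pnatr_eq0 -lt0n fact_gt0.
rewrite fctE/= exprS.
by field; rewrite if0 nat1r i0.
Qed.

(** * Limits of the primitive at 0 and at infinity *)

(** A general filter covers both ends of the half-line; the polynomial q absorbs the powers
    x^(i-k). *)
Lemma laguerre_primitive_cvg0 (R : realType) (F : set_system R) (FF : Filter F) :
  (forall n (b : R) (q : {poly R}), 0 < b ->
     q.[x] * laguerre_fun n b x @[x --> F] --> 0) ->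
  forall i n (b : R), (i <= n)%N -> 0 < b ->
  laguerre_primitive i n b x @[x --> F] --> 0.
Proof.
move=> cvgl.
have cvgl1 n (b : R) : 0 < b -> laguerre_primitive 0 n b x @[x --> F] --> 0.
  move=> b0; rewrite laguerre_primitive0.
  by have := cvgl n b 1 b0; under eq_fun do rewrite hornerC mul1r.
elim=> [|i IHi] [|n] b //; [by move=> _ /cvgl1..|]; rewrite ltnS => ilen b0.
have b1 : 0 < b + 1 by rewrite ltr_wpDr.
have := cvgB (cvgl n.+1 b (i.+1`!%:R^-1 *: 'X^(i.+1)) b0) (IHi n _ ilen b1).
rewrite subr0.
suff -> : laguerre_primitive i.+1 n.+1 b =
    (fun x => (i.+1`!%:R^-1 *: 'X^(i.+1)).[x] * laguerre_fun n.+1 b x)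
    - laguerre_primitive i n (b + 1) by apply.
apply/funext => x; rewrite laguerre_primitiveS -[RHS]/(_ * _ - _).
by rewrite hornerZ hornerXn [_^-1 * _]mulrC.
Qed.

Lemma laguerre_fun_cvg_right0 (R : realType) n (b : R) (q : {poly R}) : 0 < b ->
  q.[x] * laguerre_fun n b x @[x --> 0^'+] --> 0.
Proof.
move=> b0.
(* The limit is written factor by factor; the 0 after the constant is the limit of x^b, by b > 0. *)
suff : q.[x] * laguerre_fun n b x @[x --> 0^'+] -->
    q.[0] * (n`!%:R / Gamma (n%:R + b + 1) * 0 * expR (- 0) *
      (laguerre_poly n b).[0]) by rewrite mulr0 !mul0r mulr0.
apply: cvgM; first by apply: cvg_at_right_filter; exact: continuous_horner.
rewrite /laguerre_fun; under eq_cvg do rewrite -horner_laguerre_poly.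
apply: cvgM; last by apply: cvg_at_right_filter; exact: continuous_horner.
apply: cvgM; last first.
  apply/cvg_at_right_filter; apply: (@continuous_comp _ _ _ -%R expR).
    exact: opp_continuous.
  exact: continuous_expR.
by apply: cvgM; [exact: cvg_cst|exact: powR_cvg0].
Qed.

(** For an integer M >= c and x >= 1, x^c <= x^M and e^x >= x^(M+1)/(M+1)!, so the product lies
    between 0 and (M+1)!/x. *)
Lemma powR_expRN_cvgy (R : realType) (c : R) :
  powR x c * expR (- x) @[x --> +oo] --> 0.
Proof.
have [M cM] : exists M : nat, c <= M%:R.
  by exists (Num.truncn `|c|).+1; rewrite (le_trans (ler_norm _))// ltW// truncnS_gt.
have cvgV : (M.+1`!%:R * x^-1 : R) @[x --> +oo] --> 0.
  rewrite -[X in _ --> X](mulr0 M.+1`!%:R); apply: cvgM; first exact: cvg_cst.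
  by apply/gtr0_cvgV0; [exact: nbhs_pinfty_gt|exact: cvg_id].
apply: (squeeze_cvgr _ (cvg_cst 0) cvgV).
near=> x.
have x1 : 1 <= x by near: x; exact: nbhs_pinfty_ge.
have x0 : 0 < x by exact: lt_le_trans x1.
rewrite mulr_ge0 ?powR_ge0 ?expR_ge0//=.
have xM : powR x c <= x ^+ M by rewrite -powR_mulrn ?ler_powR// ltW.
have eM : x ^+ M.+1 / M.+1`!%:R <= expR x.
  by apply: le_trans (expR_ge1Dxn M (ltW x0)); rewrite lerDr.
rewrite expRN ler_pdivrMr ?expR_gt0// (le_trans xM)//.
rewrite -ler_pdivrMl; last by rewrite mulr_gt0 ?invr_gt0// ltr0n fact_gt0.
rewrite (le_trans _ eM)// le_eqVlt; apply/orP; left; apply/eqP.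
rewrite exprS; field.
by rewrite pnatr_eq0 -lt0n fact_gt0 (gt_eqF x0).
Unshelve. all: by end_near. Qed.

(** Induction on p for all c at once: for x > 0 a factor x is absorbed by raising c to c + 1. *)
Lemma horner_powR_expRN_cvgy (R : realType) (p : {poly R}) (c : R) :
  p.[x] * (powR x c * expR (- x)) @[x --> +oo] --> 0.
Proof.
elim/poly_ind: p c => [|p d IHp] c.
  by under eq_cvg do rewrite horner0 mul0r; exact: cvg_cst.
have : p.[x] * (powR x (c + 1) * expR (- x)) + d * (powR x c * expR (- x))
    @[x --> +oo] --> (0 + d * 0 : R).
  apply: cvgD; first exact: IHp.
  by apply: cvgM; [exact: cvg_cst|exact: powR_expRN_cvgy].
rewrite mulr0 addr0 => cvgD0; apply: cvg_trans cvgD0; apply: near_eq_cvg; near=> x.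
have x0 : 0 < x by near: x; exact: nbhs_pinfty_gt.
rewrite powRD1// hornerMXaddC.
ring.
Unshelve. all: by end_near. Qed.

Lemma laguerre_fun_cvgy (R : realType) n (b : R) (q : {poly R}) :
  q.[x] * laguerre_fun n b x @[x --> +oo] --> 0.
Proof.
pose K : R := n`!%:R / Gamma (n%:R + b + 1).
have := horner_powR_expRN_cvgy _ (K *: (q * laguerre_poly n b)) b.
move=> cvgK; apply: cvg_trans cvgK; apply: near_eq_cvg; apply: nearW => x.
rewrite hornerZ hornerM horner_laguerre_poly /laguerre_fun -/K; ring.
Qed.

Lemma laguerre_primitive_at0 (R : realType) i n (b : R) : 0 < b ->
  laguerre_primitive i n b 0 = 0.
Proof.
move=> b0; rewrite /laguerre_primitive big1// => k _.
by rewrite /laguerre_fun powR0 ?mulr0 ?mul0r ?mulr0// gt_eqF// ltr_wpDr.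
Qed.

(** * Location of the zeros, sign of the integrand, final summation *)

Theorem theorem2p3 (R : realType) (n i : nat) (a : R) (t : 'I_n -> R) :
  (i < n)%N -> -1 < a ->
  (forall j k : 'I_n, (j < k)%N -> t j < t k) ->
  (forall x : R, laguerreL n a x = 0 <-> exists m : 'I_n, x = t m) ->
  (\int[@lebesgue_measure R]_(x in `](0%R : R), +oo[%classic)
      ((x ^+ i / (i`!)%:R) * `|laguerre_fun n a x|)%:E =
   (2 * \sum_(m < n) (-1) ^+ (m.+2) *
        \sum_(k < i.+1) (-1) ^+ k / ((i - k)`!)%:R * t m ^+ (i - k) *
           laguerre_fun (n.-1 - k) (a + 1 + k%:R) (t m))%:E)%E.
Proof.
case: n t => [//|n] t; rewrite ltnS => ilen a_gt t_lt t_root.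
have a1 : 0 < a + 1 by rewrite -ltrBlDr sub0r.
have t_root' m : laguerreL n.+1 a (t m) = 0 by apply/t_root; exists m.
have t_gt0 m : 0 < t m.
  rewrite ltNge; apply/negP => /(laguerreL_gt0 _ n.+1 _ _ a_gt).
  by rewrite t_root' ltxx.
(* The breakpoints are 0 followed by the zeros; [n] is now one less than the degree, and [inord]
   keeps k for k <= n. *)
pose s m := if m is k.+1 then t (inord k) else 0.
pose f x := x ^+ i / i`!%:R * laguerre_fun n.+1 a x.
have s_lt m : (m < n.+1)%N -> s m < s m.+1.
  case: m => [|m] mn; first exact: t_gt0.
  by apply: t_lt; rewrite !inordK// ltnW.
have t_le (j k : 'I_n.+1) : (j <= k)%N -> t j <= t k.
  by rewrite leq_eqVlt => /predU1P[/ord_inj ->|/t_lt/ltW].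
have f_sign m x : (m <= n.+1)%N -> s m <= x -> ((m < n.+1)%N -> x <= s m.+1) ->
    `|f x| = (-1) ^+ m * f x.
  move=> mn smx xsm.
  have x0 : 0 <= x.
    by apply: le_trans smx; case: (m) => //= k; exact/ltW/t_gt0.
  rewrite /f /laguerre_fun (laguerreL_prod _ _ _ _ t_lt t_root').
  (* Every factor outside P is nonnegative, so P alone decides the sign. *)
  set c := _ / Gamma _; set P := \prod_(_ < _) _.
  have -> : x ^+ i / i`!%:R * (c * powR x a * expR (- x) * (n.+1`!%:R^-1 * P)) =
     x ^+ i / i`!%:R * c * powR x a * expR (- x) / n.+1`!%:R * P by ring.
  rewrite normrM ger0_norm.
    rewrite [`|P|](@norm_prod_sign _ _ _ m)//; first by rewrite mulrCA.
    - move=> j jm; apply: le_trans smx; case: m jm mn {xsm} => // m jm mn.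
      by apply: t_le; rewrite inordK.
    (* An index j >= m forces m < n + 1, so the upper bound on x is available; beyond the last zero
       no such j exists. *)
    - move=> j mj; have mn' := leq_ltn_trans mj (ltn_ord j).
      by apply: (le_trans (xsm mn')); apply: t_le; rewrite inordK.
  by rewrite divr_ge0// !mulr_ge0 ?invr_ge0 ?powR_ge0 ?expR_ge0 ?exprn_ge0 ?Gamma_ge0.
have df x : s 0 < x -> is_derive x 1 (laguerre_primitive i n (a + 1)) (f x).
  exact: is_derive_laguerre_primitive.
have cf x : s 0 < x -> {for x, continuous f}.
  move=> x0; apply: cvgM.
    by apply: cvgM; [exact: exprn_continuous|exact: cvg_cst].
  (* The derivative formula at a - 1 shows that l_(n+1)^(a) is differentiable, hence continuous. *)
  have := is_derive_laguerre_fun _ n.+1 (a - 1) _ x0.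
  by rewrite subrK; exact: is_derive_continuous.
have := integral_norm_alternating _ _ _ _ _ (ltn0Sn n) s_lt df cf f_sign
  (laguerre_primitive_at0 _ i n _ a1)
  (laguerre_primitive_cvg0 _ _ _ (laguerre_fun_cvg_right0 R) _ _ _ ilen a1)
  (laguerre_primitive_cvg0 _ _ _ (fun n b q _ => laguerre_fun_cvgy R n b q)
     _ _ _ ilen a1).
rewrite /s/= => int_f; transitivity
    (\int[@lebesgue_measure R]_(x in `]0%R, +oo[) (`|f x|)%:E)%E.
  apply: eq_integral => x; rewrite inE/= in_itv/= andbT => x0.
  have x_ge0 : 0 <= x ^+ i / i`!%:R by rewrite divr_ge0// exprn_ge0// ltW.
  by rewrite /f [in RHS]normrM (ger0_norm x_ge0).
rewrite int_f; congr (2 * _)%:E; apply: eq_bigr => m _.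
(* As [m] counts from 0, the sign (-1)^(m+2) is the (-1)^m of the alternating sum. *)
by rewrite inord_val !exprS !mulN1r opprK.
Qed.
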